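(* Let $G=(X,\mathcal E)$ be a connected finite weighted graph with weight $w$. For every $\xi\in M_0(X)$, $$\|\xi\|_G=\min_{T\in\operatorname{ST}(G)}\|\xi\|_T ,$$ where $\operatorname{ST}(G)$ is the set of spanning trees of $G$, each endowed with the weights inherited from $G$, and $\|\cdot\|_G$, $\|\cdot\|_T$ are the Arens–Eells norms on $M_0(X)$ for the graph distances of $G$ and $T$, respectively.
   Context: A weight $w$ on a finite set $X$ is a symmetric map $X\times X\to[0,\infty)$; its support defines an undirected simple graph $G=(X,\mathcal E)$ with edges $\{x,y\}$ such that $w(x,y)>0$ (no loops). The length of a path is the sum of the weights of its edges, and the graph distance $d_G(x,y)$ is the length of a shortest path joining $x$ and $y$. A spanning tree of $G$ is a tree $T=(X,\mathcal T)$ with vertex set $X$ and $\mathcal T\subset\mathcal E$; its distance $d_T$ is computed with the weights $w$ restricted to $\mathcal T$. $M_0(X)$ is the vector space of functions $\xi:X\to\mathbb R$ with $\sum_{x\in X}\xi(x)=0$. For a distance $d$ on $X$, the Arens–Eells norm on $M_0(X)$ is $$\|\xi\|=\inf\Big\{\sum_{x,y\in X}|a(x,y)|\,d(x,y)\ :\ a\in\mathbb R^{X\times X},\ \xi=\sum_{x,y\in X}a(x,y)(\delta_x-\delta_y)\Big\},$$ where $\delta_x$ is the indicator function of $\{x\}$. $\|\cdot\|_G$ and $\|\cdot\|_T$ denote this norm for $d=d_G$ and $d=d_T$. *)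

(* Defs.v *)
From mathcomp Require Import all_boot all_order all_algebra.
From mathcomp Require Import all_classical all_reals.

Set Implicit Arguments.
Unset Strict Implicit.
Unset Printing Implicit Defensive.

Import Order.TTheory GRing.Theory Num.Theory.

Local Open Scope ring_scope.

Section Graphs.
Variables (R : realType) (X : finType).
Implicit Types (w d : X -> X -> R) (E T : {set {set X}}) (xi : X -> R).

Definition is_weight w : Prop :=
  (forall x y, w x y = w y x) /\ (forall x y, 0 <= w x y).

(* An edge is an unordered pair of distinct vertices; a positive diagonal
   value [w x x] creates no loop. *)
Definition edges w : {set {set X}} :=
  [set e : {set X} |
    [exists x, exists y, [&& x != y, 0 < w x y & e == [set x; y]%SET]]]%SET.

Definition adj E : rel X := fun x y => [set x; y]%SET \in E.

Definition connected_graph E : Prop := forall x y : X, connect (adj E) x y.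

(* Cycles have at least three vertices: [ucycle] also holds of the sequence
   [:: x; y] going back and forth along a single edge. *)
Definition acyclic_graph E : Prop :=
  forall c : seq X, (2 < size c)%N -> ~ ucycle (adj E) c.

Definition spanning_trees w : set {set {set X}} :=
  [set T : {set {set X}} |
    [/\ T \subset edges w, connected_graph T & acyclic_graph T]]%classic.

(* The path with vertices [x :: p]. *)
Definition path_length w (x : X) (p : seq X) : R :=
  \sum_(l <- pairmap w x p) l.

(* Distance in the graph with edge set [E], whose edges carry the weights [w].
   It is meaningful only for vertices joined by a path in [E]: the infimum of
   the empty set is [0] by convention. *)
Definition gdist w E (x y : X) : R :=
  inf [set path_length w x p | p in
        [set p : seq X | path (adj E) x p /\ last x p = y]]%classic.

Definition M0 : set (X -> R) := [set xi | \sum_x xi x = 0]%classic.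

Definition delta (x : X) : X -> R := fun z => (z == x)%:R.

Definition arens_eells d xi : R :=
  inf [set \sum_x \sum_y `|a x y| * d x y | a in
        [set a : X -> X -> R | forall z : X,
          xi z = \sum_x \sum_y a x y * (delta x z - delta y z)]]%classic.

End Graphs.

(* Main.v *)
(** By linearity along paths, a representation [a] of [xi] is turned into an
    edge flow whose cost is about [\sum |a x y| d_G(x, y)]. Pushing a flow around
    a cycle changes its cost by a convex piecewise affine function of the amount
    pushed, so some amount that empties an edge of the cycle does not raise the
    cost. That edge can be deleted without disconnecting the graph, and
    repeating this yields a flow on a spanning tree [T]. Each edge of [T] is at
    least as long as the [d_T]-distance between its ends, so the cost of this
    flow bounds the Arens-Eells norm for [T]; one concludes by taking the best of
    the finitely many spanning trees. *)
Require Import Defs.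
From mathcomp Require Import all_boot all_order all_algebra.
From mathcomp Require Import all_classical all_reals.
From mathcomp Require Import ring lra.

Import Order.TTheory GRing.Theory Num.Theory.

Local Open Scope ring_scope.

Set Implicit Arguments.
Unset Strict Implicit.
Unset Printing Implicit Defensive.

(** * Breakpoints of convex piecewise affine costs *)

Section PiecewiseLinear.
Variables (R : realType) (I : finType) (w f g : I -> R).
Hypothesis w_ge0 : forall i, 0 <= w i.
Hypothesis w_gt0 : forall i, g i != 0 -> 0 < w i.

Let cost (h : I -> R) := \sum_i `|h i| * w i.

(* The slope at [0] of [t |-> cost (f + t g)] is nonpositive, and the cost stays
   affine until the first positive [t] at which some [f i + t g i] vanishes. *)
Lemma breakpoint_of_slope_le0 i0 : g i0 != 0 ->
    (forall i, g i != 0 -> f i != 0) ->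
    \sum_i Num.sg (f i) * g i * w i <= 0 ->
  exists t i, [/\ g i != 0, f i + t * g i = 0 &
    cost (fun j => f j + t * g j) <= cost f].
Proof.
move=> gi0 fn0 slope.
(* If no entry moved towards zero for [t > 0], all slope terms would be nonnegative and the one at
   [i0], where the weight is positive, strictly so. *)
have [i1 Pi1] : exists i, f i * g i < 0.
  apply/existsP; apply: contraT => /existsPn fg_ge0.
  have sg_ge0 i : 0 <= Num.sg (f i) * g i.
    have := fg_ge0 i; case: (sgrP (f i)) => [->|fi|fi]; nra.
  have : 0 < Num.sg (f i0) * g i0 * w i0.
    rewrite mulr_gt0 ?w_gt0// lt0r sg_ge0 andbT mulf_neq0// sgr_eq0.
    exact: fn0.
  rewrite ltNge => /negP[]; apply: le_trans slope.
  rewrite (bigD1 i0)//= lerDl sumr_ge0// => i _.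
  by rewrite mulr_ge0.
(* Entries moving towards zero vanish at time [- f i / g i]; the minimiser is the first one to do
   so. *)
case: (@Order.TotalTheory.arg_minP _ R I i1 (fun i => f i * g i < 0)
  (fun i => - f i / g i) Pi1) => i fgi i_min.
set t := - f i / g i in i_min.
have gi : g i != 0 by apply: contraTneq fgi => ->; rewrite mulr0 ltxx.
have tgi : t * g i = - f i by rewrite divfK.
have t_gt0 : 0 < t.
  have : 0 < t * (g i * g i) by rewrite mulrA tgi mulNr oppr_gt0.
  by rewrite pmulr_lgt0// -expr2 exprn_even_gt0.
exists t, i; split=> //; first by rewrite tgi subrr.
have normE j : `|f j + t * g j| = `|f j| + t * (Num.sg (f j) * g j).
  have [gj|gj] := eqVneq (g j) 0; first by rewrite gj !mulr0 !addr0.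
  have fg_tle : f j * g j < 0 -> t * (g j * g j) <= - (f j * g j).
    move=> /[dup] fgj /i_min tle.
    have -> : - (f j * g j) = - f j / g j * (g j * g j) by field.
    by rewrite ler_pM2r// -expr2 exprn_even_gt0.
  have := fn0 _ gj; case: (sgrP (f j)) => [fj|fj|fj]; first by [].
  - move=> _; rewrite mul1r ger0_norm//; have [|gj0] := leP 0 (g j); first by nra.
    have := fg_tle; nra.
  - move=> _; rewrite mulN1r ler0_norm; first by lra.
    have [|gj0] := leP (g j) 0; first by nra.
    have := fg_tle; nra.
rewrite /cost; under eq_bigr do rewrite normE mulrDl -mulrA.
by rewrite big_split/= -mulr_sumr; nra.
Qed.

End PiecewiseLinear.

(** Unless [t = 0] already works, the cost is affine near [0]; going against its slope, by replacing
    [g] with [- g] if needed, reaches a breakpoint without raising it. *)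
Lemma exists_breakpoint (R : realType) (I : finType) (w f g : I -> R) i0 :
    (forall i, 0 <= w i) -> (forall i, g i != 0 -> 0 < w i) -> g i0 != 0 ->
  exists t i, [/\ g i != 0, f i + t * g i = 0 &
    \sum_j `|f j + t * g j| * w j <= \sum_j `|f j| * w j].
Proof.
move=> w_ge0 w_gt0 gi0.
have [[i [gi fi]]|f_neq0] := pselect (exists i, g i != 0 /\ f i = 0).
  exists 0, i; split=> //; first by rewrite fi mul0r addr0.
  by under eq_bigr do rewrite mul0r addr0.
have fn0 i : g i != 0 -> f i != 0.
  by move=> gi; apply/eqP => fi; apply: f_neq0; exists i.
have [slope|slope] := leP (\sum_i Num.sg (f i) * g i * w i) 0.
  exact: breakpoint_of_slope_le0 gi0 fn0 slope.
have gN i : (- g i != 0) = (g i != 0) by rewrite oppr_eq0.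
have [||||t [i [gi fi le_cost]]] :=
    @breakpoint_of_slope_le0 R I w f (fun i => - g i) w_ge0 _ i0.
- by move=> i; rewrite gN; apply: w_gt0.
- by rewrite gN.
- by move=> i; rewrite gN; apply: fn0.
- under eq_bigr do rewrite mulrN mulNr.
  by rewrite sumrN oppr_le0 ltW.
exists (- t), i; split; [by rewrite -gN|by rewrite mulNr -mulrN|].
by under eq_bigr do rewrite mulNr -mulrN.
Qed.

Section Graphs.
Variables (R : realType) (X : finType).
Implicit Types (w d : X -> X -> R) (E T : {set {set X}}) (xi : X -> R).

(** * Edges, paths and graph distances *)

Lemma adj_sym E : symmetric (adj E).
Proof. by move=> x y; rewrite /adj finset.setUC. Qed.

Lemma set2_inj (x y a b : X) : [set x; y]%SET = [set a; b]%SET ->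
  (x = a /\ y = b) \/ (x = b /\ y = a).
Proof.
move=> /finset.setP e.
have := e x; have := e y; have := e a; have := e b; rewrite !inE !eqxx /= !orbT.
by do 4! [case: eqP => ? /=]; subst; auto; repeat case: eqP => ? //=; subst; auto.
Qed.

Lemma adj_edges w E x y : is_weight w -> E \subset edges w -> adj E x y ->
  0 < w x y.
Proof.
move=> [w_sym _] /fintype.subsetP sEw /sEw; rewrite inE.
move=> /existsP[a /existsP[b /and3P[_ wab /eqP/set2_inj]]].
by case=> -[-> ->] //; rewrite w_sym.
Qed.

Lemma sub_adj T E : T \subset E -> subrel (adj T) (adj E).
Proof. by move=> /fintype.subsetP TE x y /TE. Qed.

Lemma path_length_ge0 w x p : is_weight w -> 0 <= path_length w x p.
Proof.
move=> [_ w_ge0]; rewrite /path_length.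
elim: p x => [|y p IHp] x /=; first by rewrite big_nil.
by rewrite big_cons addr_ge0.
Qed.

Lemma gdist_lbound w E x y : is_weight w ->
  lbound [set path_length w x p | p in
    [set p : seq X | path (adj E) x p /\ last x p = y]]%classic 0.
Proof. by move=> hw _ [p _ <-]; apply: path_length_ge0. Qed.

Lemma gdist_nonempty w E x y : connected_graph E ->
  ([set path_length w x p | p in
    [set p : seq X | path (adj E) x p /\ last x p = y]] !=set0)%classic.
Proof.
by move=> /(_ x y)/connectP[p pE ->]; exists (path_length w x p), p.
Qed.

Lemma gdist_le_path w E x p : is_weight w -> path (adj E) x p ->
  gdist w E x (last x p) <= path_length w x p.
Proof.
move=> hw xp; apply: ge_inf; last by exists p.
by exists 0; apply: gdist_lbound.
Qed.

Lemma gdist_ge0 w E x y : is_weight w -> connected_graph E ->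
  0 <= gdist w E x y.
Proof.
by move=> hw hE; apply: lb_le_inf;
  [apply: gdist_nonempty | apply: gdist_lbound].
Qed.

Lemma gdist_le_adj w E x y : is_weight w -> adj E x y -> gdist w E x y <= w x y.
Proof.
move=> hw xy; have := @gdist_le_path w E x [:: y] hw.
by rewrite /= xy /path_length /= big_seq1; apply.
Qed.

Lemma gdist_sub w T E x y : is_weight w -> connected_graph T ->
  T \subset E -> gdist w E x y <= gdist w T x y.
Proof.
move=> hw hT TE; apply: lb_le_inf; first exact: gdist_nonempty.
move=> _ [p [xp <-] <-]; apply: gdist_le_path => //.
exact: sub_path (sub_adj TE) _ _ xp.
Qed.

(** Nearly shortest paths suffice, because the error [e] is made arbitrarily small at the end. *)
Lemma gdist_path_lt w E x y (e : R) : is_weight w -> connected_graph E ->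
    0 < e ->
  exists p, [/\ path (adj E) x p, last x p = y &
    path_length w x p < gdist w E x y + e].
Proof.
move=> hw hE e_gt0; have [|_ [p [xp py] <-] lt] := inf_adherent e_gt0 (E :=
  [set path_length w x p | p in
    [set p : seq X | path (adj E) x p /\ last x p = y]]%classic).
  split; first exact: gdist_nonempty.
  by exists 0; apply: gdist_lbound.
by exists p.
Qed.

(** * Representations and the Arens-Eells norm *)

Definition represents xi (a : X -> X -> R) :=
  forall z, xi z = \sum_x \sum_y a x y * (delta R x z - delta R y z).

Lemma sum_delta (h : X -> R) z : \sum_x h x * delta R x z = h z.
Proof.
rewrite (bigD1 z)//= /delta eqxx mulr1 big1 ?addr0// => x xz.
by rewrite eq_sym (negPf xz) mulr0.
Qed.

Lemma sum_delta1 (x : X) : \sum_y delta R x y = 1.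
Proof. by rewrite (bigD1 x)//= /delta eqxx big1 ?addr0// => y /negPf->. Qed.

Lemma representsE xi a : represents xi a <->
  forall z, xi z = \sum_y a z y - \sum_x a x z.
Proof.
have sumE z : \sum_x \sum_y a x y * (delta R x z - delta R y z) =
    \sum_y a z y - \sum_x a x z.
  under eq_bigr do under eq_bigr do rewrite mulrBr.
  under eq_bigr do rewrite sumrB sum_delta -mulr_suml.
  by rewrite sumrB sum_delta.
by split=> h z; rewrite h sumE.
Qed.

(** All mass is sent to a base point [x0], where the total received is zero. This makes the infimum
    defining the norm range over a nonempty set. *)
Lemma M0_represents xi : M0 xi -> exists a, represents xi a.
Proof.
move=> xi0; case: (pickP X) => [x0 _|X0]; last first.
  by exists (fun _ _ => 0) => z; have := X0 z.
exists (fun x y => xi x * delta R x0 y); apply/representsE => z.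
have -> : \sum_x xi x * delta R x0 z = 0 by rewrite -mulr_suml xi0 mul0r.
by rewrite -mulr_sumr sum_delta1 mulr1 subr0.
Qed.

Lemma arens_eells_le d xi a : (forall x y, 0 <= d x y) -> represents xi a ->
  arens_eells d xi <= \sum_x \sum_y `|a x y| * d x y.
Proof.
move=> d_ge0 ha; apply: ge_inf; last by exists a.
exists 0 => _ [b _ <-]; apply: sumr_ge0 => x _; apply: sumr_ge0 => y _.
by rewrite mulr_ge0.
Qed.

Lemma le_arens_eells d xi (c : R) : M0 xi ->
    (forall a, represents xi a -> c <= \sum_x \sum_y `|a x y| * d x y) ->
  c <= arens_eells d xi.
Proof.
move=> /M0_represents[a ha] hc; apply: lb_le_inf.
  by exists (\sum_x \sum_y `|a x y| * d x y), a.
by move=> _ [b hb <-]; apply: hc.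
Qed.

Lemma arens_eells_mono d d' xi : M0 xi -> (forall x y, 0 <= d x y) ->
    (forall x y, d x y <= d' x y) ->
  arens_eells d xi <= arens_eells d' xi.
Proof.
move=> xi0 d_ge0 dd'; apply: le_arens_eells => // a ha.
apply: le_trans (arens_eells_le d_ge0 ha) _.
by apply: ler_sum => x _; apply: ler_sum => y _; rewrite ler_wpM2l.
Qed.

(** * Edge flows and their cost *)

(* Both orientations of an edge are counted in the sum, hence the factor 2. *)
Definition has_flow w E xi (c : R) := exists f : X -> X -> R,
  [/\ forall x y, f y x = - f x y,
      forall x y, f x y != 0 -> adj E x y,
      forall z, xi z = \sum_y f z y &
      \sum_x \sum_y `|f x y| * w x y <= c *+ 2].

Lemma has_flow0 w E : has_flow w E (fun=> 0) 0.
Proof.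
exists (fun _ _ => 0); split=> [x y|x y|z|].
- by rewrite oppr0.
- by rewrite eqxx.
- by rewrite big1.
- by rewrite mul0rn big1// => x _; rewrite big1// => y _; rewrite normr0 mul0r.
Qed.

Lemma has_flow_le w E xi c c' : c <= c' ->
  has_flow w E xi c -> has_flow w E xi c'.
Proof.
move=> le_cc' [f [fN fE fx fc]]; exists f; split=> //.
by apply: le_trans fc _; rewrite lerMn2r le_cc' orbT.
Qed.

Lemma has_flowD w E xi1 xi2 c1 c2 : is_weight w ->
    has_flow w E xi1 c1 -> has_flow w E xi2 c2 ->
  has_flow w E (fun z => xi1 z + xi2 z) (c1 + c2).
Proof.
move=> [_ w_ge0] [f1 [fN1 fE1 fx1 fc1]] [f2 [fN2 fE2 fx2 fc2]].
exists (fun x y => f1 x y + f2 x y); split=> [x y|x y|z|].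
- by rewrite fN1 fN2 opprD.
- have [f10|/fE1//] := eqVneq (f1 x y) 0.
  by rewrite f10 add0r; apply: fE2.
- by rewrite big_split/= fx1 fx2.
- rewrite mulrnDl; apply: le_trans (lerD fc1 fc2).
  rewrite -big_split/=; apply: ler_sum => x _.
  rewrite -big_split/=; apply: ler_sum => y _.
  by rewrite -mulrDl ler_wpM2r// ler_normD.
Qed.

Lemma has_flowZ w E xi c (k : R) :
  has_flow w E xi c -> has_flow w E (fun z => k * xi z) (`|k| * c).
Proof.
move=> [f [fN fE fx fc]]; exists (fun x y => k * f x y); split=> [x y|x y|z|].
- by rewrite fN mulrN.
- by rewrite mulf_eq0 negb_or => /andP[_ /fE].
- by rewrite fx mulr_sumr.
- rewrite -mulrnAr; apply: le_trans (ler_wpM2l (normr_ge0 k) fc).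
  rewrite mulr_sumr; apply: ler_sum => x _.
  by rewrite mulr_sumr; apply: ler_sum => y _; rewrite normrM mulrA.
Qed.

Lemma has_flow_sum w E (I : finType) (xi : I -> X -> R) (c : I -> R) :
    is_weight w -> (forall i, has_flow w E (xi i) (c i)) ->
  has_flow w E (fun z => \sum_i xi i z) (\sum_i c i).
Proof.
move=> hw h; elim: (index_enum I) => [|i s IHs].
  by rewrite big_nil; under eq_fun do rewrite big_nil; apply: has_flow0.
by rewrite big_cons; under eq_fun do rewrite big_cons; apply: has_flowD.
Qed.

Lemma has_flow_edge w E x y : is_weight w -> adj E x y ->
  has_flow w E (fun z => delta R x z - delta R y z) (w x y).
Proof.
move=> [w_sym w_ge0] xy.
(* [h x y] is the indicator of the ordered pair [(x, y)]; subtracting [h y x] makes it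
   antisymmetric. *)
pose h (x y u v : X) : R := delta R x u * delta R y v.
have sumh a b : \sum_u \sum_v h a b u v * w u v = w a b.
  rewrite (bigD1 a)//= (bigD1 b)//= /h /delta !eqxx !mul1r.
  rewrite !big1 ?addr0// => [u /negPf ua|v /negPf vb].
    by rewrite big1// => v _; rewrite ua !mul0r.
  by rewrite vb !(mulr0, mul0r).
exists (fun u v => h x y u v - h y x u v); split=> [u v|u v|z|].
- by rewrite /h; ring.
- rewrite /h /delta -!natrM !mulnb.
  case: andP => [[/eqP-> /eqP->]//|_].
  case: andP => [[/eqP-> /eqP->] _|_]; first by rewrite adj_sym.
  by rewrite subrr eqxx.
- by rewrite sumrB -!mulr_sumr !sum_delta1 !mulr1.
- rewrite mulr2n -{1}(sumh x y) w_sym -(sumh y x) -big_split/=.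
  apply: ler_sum => u _; rewrite -big_split/=; apply: ler_sum => v _.
  rewrite -mulrDl ler_wpM2r//; apply: le_trans (ler_normB _ _) _.
  by rewrite !ger0_norm ?mulr_ge0.
Qed.

Lemma has_flow_path w E x p : is_weight w -> path (adj E) x p ->
  has_flow w E (fun z => delta R x z - delta R (last x p) z)
    (path_length w x p).
Proof.
move=> hw; rewrite /path_length.
elim: p x => [|y p IHp] x /=.
  by rewrite big_nil => _; under eq_fun do rewrite subrr; apply: has_flow0.
move=> /andP[xy yp]; rewrite big_cons.
have := has_flowD hw (has_flow_edge hw xy) (IHp y yp).
by congr has_flow; apply/funext => z; rewrite addrA subrK.
Qed.

(** The amount [a x y] is routed along a path from [x] to [y] that is within [e] of the distance,
    and these flows are superposed. *)
Lemma has_flow_represents w E xi a (e : R) : is_weight w ->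
    connected_graph E -> represents xi a -> 0 < e ->
  has_flow w E xi (\sum_x \sum_y `|a x y| * (gdist w E x y + e)).
Proof.
move=> hw hE ha e_gt0; rewrite (funext ha).
apply: has_flow_sum => // x; apply: has_flow_sum => // y.
have [p [xp <- /ltW lp]] := gdist_path_lt x y hw hE e_gt0.
apply: has_flow_le (has_flowZ _ (has_flow_path hw xp)).
by rewrite ler_wpM2l.
Qed.

Lemma arens_eells_le_flow w T xi c : is_weight w -> connected_graph T ->
  has_flow w T xi c -> arens_eells (gdist w T) xi <= c.
Proof.
move=> hw hT [f [fN fE fx fc]].
(* By antisymmetry, row sums minus column sums of [f] give twice [xi]; halving also absorbs the
   factor 2 in the cost. *)
have half_rep : represents xi (fun x y => f x y / 2).
  apply/representsE => z; rewrite -!mulr_suml -fx.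
  under [X in _ - X / 2]eq_bigr do rewrite fN.
  by rewrite sumrN -fx; lra.
apply: le_trans (arens_eells_le _ half_rep) _.
  by move=> x y; apply: gdist_ge0.
have -> : c = c *+ 2 / 2 by lra.
apply: le_trans (ler_wpM2r _ fc); last by lra.
rewrite mulr_suml; apply: ler_sum => x _.
rewrite mulr_suml; apply: ler_sum => y _.
have [->|/fE xy] := eqVneq (f x y) 0; first by rewrite !(mul0r, normr0).
rewrite normrM mulrAC [`|2^-1|]ger0_norm; last by lra.
by rewrite ler_wpM2r ?ler_wpM2l ?gdist_le_adj//; lra.
Qed.

(** * Deleting an edge of a cycle *)

Lemma rot_to3 (c : seq X) x : (2 < size c)%N -> x \in c ->
  exists i y z s, rot i c = [:: x, y, z & s].
Proof.
move=> c3 /rot_to[i s def]; exists i; move: c3; rewrite -(size_rot i) def.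
by case: s {def} => [|y [|z s]]//= _; exists y, z, s.
Qed.

(** Ensures that the unit flow along [c] does not cancel itself on an edge, as it would on a cycle
    of length two. *)
Lemma next_next_neq (c : seq X) x : uniq c -> (2 < size c)%N -> x \in c ->
  next c (next c x) != x.
Proof.
move=> Uc c3 /(rot_to3 c3)[i [y [z [s def]]]].
rewrite -!(next_rot i Uc) def.
move: Uc; rewrite -(rot_uniq i) def /= !inE !negb_or eqxx.
move=> /and3P[/and3P[xy xz _] _ _].
by rewrite (eq_sym y) (negPf xy) eqxx eq_sym.
Qed.

(* The rest of the cycle joins the ends of the removed edge. *)
Lemma cycle_connect_setD1 E (c : seq X) x : ucycle (adj E) c ->
    (2 < size c)%N -> x \in c ->
  connect (adj (E :\ [set x; next c x]%SET)) (next c x) x.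
Proof.
move=> /[dup] /andP[_ Uc] Ec c3 /(rot_to3 c3)[i [y [z [s def]]]].
rewrite -(next_rot i Uc).
move: Ec; rewrite -(rot_ucycle i) def => /andP[/= /and3P[xy yz zs]].
rewrite !inE !negb_or eqxx => /and3P[/and3P[xNy xNz xs] /andP[yNz ys] /andP[zs' Us]].
set E' := E :\ _.
have yz' : adj E' y z.
  rewrite /adj !inE; apply/andP; split=> //.
  by apply/eqP => /set2_inj[] [yE zE]; move: xNy xNz; rewrite ?zE ?yE eqxx.
apply: connect_trans (connect1 yz') _; apply/connectP.
exists (rcons s x); last by rewrite last_rcons.
(* From [z] on, the path back to [x] avoids [y], so it never uses the deleted edge. *)
apply: (@sub_in_path _ (predC1 y)) zs => [u v uy vy uv|].
  rewrite /adj !inE; apply/andP; split=> //.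
  by apply/eqP => /set2_inj[] [uE vE]; move: uy vy; rewrite !inE ?uE ?vE eqxx.
rewrite /= all_rcons /= xNy eq_sym yNz /=.
by apply/allP => u us; apply: contraNneq ys => <-.
Qed.

(** Any passage through the deleted edge is rerouted along the remaining connection of its ends. *)
Lemma connected_setD1 E x y : connected_graph E ->
  connect (adj (E :\ [set x; y]%SET)) x y -> connected_graph (E :\ [set x; y]%SET).
Proof.
move=> hE xy u v; apply: connect_sub (hE u v) => {u v} u v uv.
have [/set2_inj[[-> ->]|[-> ->]]|ne] := eqVneq [set u; v]%SET [set x; y]%SET.
- by [].
- by rewrite (sym_connect_sym (adj_sym _)).
- by apply: connect1; rewrite /adj !inE ne.
Qed.

(** * Circulation around a cycle *)

Section CycleFlow.
Variable c : seq X.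
Hypothesis Uc : uniq c.

Definition cycle_flow x y : R :=
  ((x \in c) && (y == next c x))%:R - ((y \in c) && (x == next c y))%:R.

Lemma cycle_flowN x y : cycle_flow y x = - cycle_flow x y.
Proof. by rewrite opprB. Qed.

(** A vertex of the cycle sends one unit to its successor and receives one from its predecessor, so
    pushing flow around [c] preserves [xi]. *)
Lemma sum_cycle_flow z : \sum_y cycle_flow z y = 0.
Proof.
have sum1 (b : bool) (a : X) : \sum_y (b && (y == a))%:R = b%:R :> R.
  rewrite (bigD1 a)//= eqxx andbT big1 ?addr0// => y /negPf->.
  by rewrite andbF.
rewrite sumrB sum1.
under eq_bigr => y _.
  have -> : (y \in c) && (z == next c y) = (z \in c) && (y == prev c z).
    apply/andP/andP => -[+ /eqP ->].
      by rewrite mem_next prev_next.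
    by rewrite mem_prev next_prev.
  over.
by rewrite sum1 subrr.
Qed.

Lemma cycle_flow_neq0 x y : cycle_flow x y != 0 ->
  (x \in c /\ y = next c x) \/ (y \in c /\ x = next c y).
Proof.
rewrite /cycle_flow; case: andP => [[xc /eqP->]|_]; first by left.
by case: andP => [[yc /eqP->]|_]; [right | rewrite subrr eqxx].
Qed.

End CycleFlow.

(** * Reduction of a flow to a spanning tree *)

Lemma break_cycle w E xi k (c : seq X) : is_weight w -> E \subset edges w ->
    connected_graph E -> (2 < size c)%N -> ucycle (adj E) c ->
    has_flow w E xi k ->
  exists2 e, e \in E & connected_graph (E :\ e) /\ has_flow w (E :\ e) xi k.
Proof.
move=> hw Ew hE c3 /[dup] Ec /andP[cE Uc] [f [fN fE fx fc]].
pose g := cycle_flow c.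
have gE x y : g x y != 0 -> adj E x y.
  move=> /cycle_flow_neq0[] [xc ->]; first exact: next_cycle.
  by rewrite adj_sym; apply: next_cycle.
have [x0 x0c] : exists x, x \in c by case: (c) c3 => // x s _; exists x; rewrite mem_head.
have g0 : g x0 (next c x0) != 0.
  rewrite /g /cycle_flow x0c eqxx mem_next x0c /= [x0 == _]eq_sym.
  by rewrite (negPf (next_next_neq Uc c3 x0c)) subr0 oner_eq0.
(* The breakpoint is sought over ordered pairs; [g] lives on the cycle, so the emptied pair is one
   of its edges. *)
have [|p gp|t [[x y] /= [gxy fxy le_cost]]] :=
  @exists_breakpoint R (X * X)%type (fun p => w p.1 p.2) (fun p => f p.1 p.2)
    (fun p => g p.1 p.2) (x0, next c x0) _ _ g0.
- by move=> p; apply: (proj2 hw).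
- by apply: adj_edges hw Ew _; apply: gE.
exists [set x; y]%SET; first exact: gE.
split.
  apply: connected_setD1 => //.
  case: (cycle_flow_neq0 gxy) => -[xc ->].
    by rewrite (sym_connect_sym (adj_sym _)); apply: cycle_connect_setD1.
  by rewrite finset.setUC; apply: cycle_connect_setD1.
pose h u v := f u v + t * g u v.
have hN u v : h v u = - h u v by rewrite /h fN /g cycle_flowN mulrN opprD.
exists h; split=> // [u v huv|z|].
- rewrite /adj !inE; apply/andP; split.
    (* Antisymmetry empties the other orientation of the edge as well. *)
    apply: contraNneq huv => /set2_inj[] [-> ->]; first by rewrite /h fxy.
    by rewrite hN /h fxy oppr0.
  have [fuv|/fE//] := eqVneq (f u v) 0.
  by apply: gE; apply: contraNneq huv => guv; rewrite /h fuv guv mulr0 addr0.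
- by rewrite big_split/= -mulr_sumr sum_cycle_flow// mulr0 addr0.
- by apply: le_trans fc; rewrite !pair_big.
Qed.

(** Induction on the number of edges: each remaining cycle loses an edge at no extra cost. *)
Lemma flow_on_tree w E xi k : is_weight w -> E \subset edges w ->
    connected_graph E -> has_flow w E xi k ->
  exists2 T, spanning_trees w T & has_flow w T xi k.
Proof.
move=> hw; have [n] := ubnP #|E|; elim: n E => // n IHn E ltEn Ew hE hf.
have [acE|] := pselect (acyclic_graph E); first by exists E.
move=> /existsNP[c /not_implyP[c3 /contrapT Ec]].
have [e eE [hE' hf']] := break_cycle hw Ew hE c3 Ec hf.
apply: IHn hE' hf'; last exact: fintype.subset_trans (subD1set _ _) Ew.
by move: ltEn; rewrite (cardsD1 e) eE.
Qed.

End Graphs.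

Theorem theorem8 (R : realType) (X : finType) (w : X -> X -> R)
    (hw : is_weight w) (hconn : connected_graph (edges w))
    (xi : X -> R) (hxi : M0 xi) :
  (exists2 T : {set {set X}}, spanning_trees w T &
     arens_eells (gdist w (edges w)) xi = arens_eells (gdist w T) xi) /\
  (forall T : {set {set X}}, spanning_trees w T ->
     arens_eells (gdist w (edges w)) xi <= arens_eells (gdist w T) xi).
Proof.
(* A tree offers fewer paths, so its distance dominates that of the graph. *)
have le_tree T : spanning_trees w T ->
    arens_eells (gdist w (edges w)) xi <= arens_eells (gdist w T) xi.
  move=> [Tw hT _]; apply: arens_eells_mono => // x y.
    exact: gdist_ge0.
  exact: gdist_sub.
split=> //.
have tree a (e : R) : represents xi a -> 0 < e ->
    exists2 T, spanning_trees w T &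
      arens_eells (gdist w T) xi <=
        \sum_x \sum_y `|a x y| * (gdist w (edges w) x y + e).
  move=> ha e_gt0.
  have [T [Tw hT aT] hf] := flow_on_tree hw (fintype.subxx _) hconn
    (has_flow_represents hw hconn ha e_gt0).
  by exists T => //; apply: arens_eells_le_flow.
have [a0 ha0] := M0_represents hxi.
(* Only the existence of some spanning tree matters here, to start the minimisation; the error [1]
   is arbitrary. *)
have [T0 hT0 _] := tree a0 1 ha0 ltr01.
have PT0 : `[< spanning_trees w T0 >] by apply/asboolP.
case: (@Order.TotalTheory.arg_minP _ R _ T0
  (fun T => `[< spanning_trees w T >])
  (fun T => arens_eells (gdist w T) xi) PT0) => T /asboolP hT T_min.
exists T => //; apply/le_anti; rewrite le_tree//=.
apply: le_arens_eells => // a ha.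
set S := \sum_x \sum_y `|a x y|.
have S_ge0 : 0 <= S by apply: sumr_ge0 => x _; apply: sumr_ge0.
apply/ler_addgt0Pr => e e_gt0.
(* The error adds [S * (e / (S + 1))], at most [e], to the cost; the [+ 1] covers [S = 0]. The tree
   [T'] depends on [a] and [e], but the minimising [T] does not. *)
have e'_gt0 : 0 < e / (S + 1) by rewrite divr_gt0//; lra.
have [T' /asboolP hT' le_T'] := tree a _ ha e'_gt0.
apply: le_trans (T_min _ hT') (le_trans le_T' _).
under eq_bigr do under eq_bigr do rewrite mulrDr.
under eq_bigr do rewrite big_split/= -[X in _ + X]mulr_suml.
rewrite big_split/= lerD2l.
rewrite -mulr_suml -/S mulrCA ler_piMr//; first exact: ltW.
by rewrite ler_pdivrMr ?mul1r; lra.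
Qed.
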